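(* For a sequence $a=(a_k)_{k\ge1}\in\omega$ let $U=U(a)=(u_{nk})_{n,k\ge1}$ be the infinite matrix with $$u_{nk}=\begin{cases}\dfrac{a_k}{k}-\dfrac{a_{k+1}}{k+1}, & k<n,\\[2mm] \dfrac{a_n}{n}, & k=n,\\[1mm] 0, & k>n.\end{cases}$$ Then $$[c_0(\Omega)]^\beta=\{a\in\omega: U\in(c_0:c)\},\quad [c(\Omega)]^\beta=\{a\in\omega: U\in(c:c)\},\quad [\ell_\infty(\Omega)]^\beta=\{a\in\omega: U\in(\ell_\infty:c)\},$$ $$[c_0(\Omega)]^\gamma=\{a\in\omega: U\in(c_0:\ell_\infty)\},\quad [c(\Omega)]^\gamma=\{a\in\omega: U\in(c:\ell_\infty)\},\quad [\ell_\infty(\Omega)]^\gamma=\{a\in\omega: U\in(\ell_\infty:\ell_\infty)\}.$$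
   Context: $\omega$ is the space of all real (or complex) sequences $x=(x_k)_{k\ge1}$; $\ell_\infty$, $c$, $c_0$ are the spaces of bounded, convergent and null sequences; $cs$ and $bs$ are the spaces of sequences whose series of partial sums $\left(\sum_{k=1}^n x_k\right)_n$ is convergent, respectively bounded. The infinite matrix $\Omega=(\omega_{nk})_{n,k\ge1}$ has $\omega_{nk}=k$ for $1\le k\le n$ and $\omega_{nk}=0$ for $k>n$, so $(\Omega x)_n=\sum_{k=1}^n kx_k$, and for $X\in\{\ell_\infty,c,c_0\}$, $X(\Omega)=\{x\in\omega:\Omega x\in X\}$. For $X\subset\omega$, the $\beta$-dual is $X^\beta=\{a\in\omega:(a_kx_k)_k\in cs\text{ for all }x\in X\}$ and the $\gamma$-dual is $X^\gamma=\{a\in\omega:(a_kx_k)_k\in bs\text{ for all }x\in X\}$. $(X:Y)$ denotes the class of infinite matrices $A=(a_{nk})$ such that for every $x\in X$ the series $(Ax)_n=\sum_k a_{nk}x_k$ converges for every $n$ and $Ax=((Ax)_n)_n\in Y$. *)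

(* Defs.v *)
From HB Require Import structures.
From mathcomp Require Import all_boot all_order all_algebra.
From mathcomp Require Import all_classical all_reals all_analysis.
Set Implicit Arguments.
Unset Strict Implicit.
Unset Printing Implicit Defensive.
Import Order.TTheory GRing.Theory Num.Theory.
Import numFieldNormedType.Exports.
Local Open Scope classical_set_scope.
Local Open Scope ring_scope.

(* Indices start at 0: the term x k of a sequence (resp. the entry A n k of an
   infinite matrix) stands for x_{k+1} (resp. a_{n+1,k+1}) of the 1-based
   convention, so that the scalar "k" is written k.+1%:R.

   The scalar field K is an arbitrary numFieldType with the topology of its
   norm; real sequences are obtained with K := R and complex sequences with
   K := R[i], for R : realType. *)

Section SequenceSpaces.
Variable K : numFieldType.

Definition seq_linfty : set (nat -> K) := [set x | bounded_fun x].
Definition seq_c : set (nat -> K) := [set x | cvgn x].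
Definition seq_c0 : set (nat -> K) := [set x | x @ \oo --> (0 : K)].

(* [series x] n is the sum of the first n terms; its first value is the empty
   sum 0, which affects neither convergence nor boundedness. *)
Definition seq_cs : set (nat -> K) := [set x | cvgn (series x)].
Definition seq_bs : set (nat -> K) := [set x | bounded_fun (series x)].

Definition beta_dual (X : set (nat -> K)) : set (nat -> K) :=
  [set a | forall x, X x -> seq_cs (fun k => a k * x k)].
Definition gamma_dual (X : set (nat -> K)) : set (nat -> K) :=
  [set a | forall x, X x -> seq_bs (fun k => a k * x k)].

Definition infmx : Type := nat -> nat -> K.

Definition infmx_defined (A : infmx) (x : nat -> K) : Prop :=
  forall n, cvgn (series (fun k => A n k * x k)).

(* Meaningful only when [infmx_defined A x] holds. *)
Definition infmx_apply (A : infmx) (x : nat -> K) : nat -> K :=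
  fun n => limn (series (fun k => A n k * x k)).

Definition infmx_class (X Y : set (nat -> K)) : set infmx :=
  [set A | forall x, X x -> infmx_defined A x /\ Y (infmx_apply A x)].

Definition infmx_domain (X : set (nat -> K)) (A : infmx) : set (nat -> K) :=
  [set x | infmx_defined A x /\ X (infmx_apply A x)].

Definition Omega_mx : infmx :=
  fun n k => if (k <= n)%N then k.+1%:R else 0.

Definition U_mx (a : nat -> K) : infmx :=
  fun n k => if (k < n)%N then a k / k.+1%:R - a k.+1 / k.+2%:R
             else if k == n then a n / n.+1%:R
             else 0.

End SequenceSpaces.

Arguments seq_linfty {K}.
Arguments seq_c {K}.
Arguments seq_c0 {K}.
Arguments seq_cs {K}.
Arguments seq_bs {K}.
Arguments Omega_mx {K}.

(* Main.v *)
(** Abel summation: writing [y = Omega x], the n-th partial sum of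
    [sum_k a_k x_k] equals [(U y)_n]. Since [Omega] is a bijection of the
    space of all sequences, [x] ranges over [X(Omega)] exactly when [y]
    ranges over [X]. *)
Require Import Defs.
From mathcomp Require Import all_boot all_order all_algebra.
From mathcomp Require Import all_classical all_reals all_analysis.
Local Open Scope classical_set_scope.

Import Order.TTheory GRing.Theory Num.Theory.
Import numFieldNormedType.Exports.
Local Open Scope ring_scope.

Section DualsOfOmegaDomain.
Variable K : numFieldType.
Implicit Types (u a x y : nat -> K) (A : infmx K) (X Y Z : set (nat -> K)).

Lemma cvg_series_finite u n :
  (forall k, (n <= k)%N -> u k = 0) -> series u @ \oo --> (series u n : K).
Proof.
move=> u0; apply: cvg_near_cst; exists n => // m /= le_nm.
rewrite !seriesEnat /= (big_cat_nat (leq0n n) le_nm) //=.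
by rewrite [X in _ + X]big_nat_cond
  [X in _ + X]big1 ?addr0 // => k /andP[/andP[/u0]].
Qed.

(** Rows of such a matrix have finite support, so each series defining [infmx_apply] is eventually
    constant: definedness is automatic, and limits become finite sums that can be manipulated
    algebraically. *)
Definition lower_triangular A := forall n k, (n < k)%N -> A n k = 0.

Lemma triangular_defined A x : lower_triangular A -> infmx_defined A x.
Proof.
move=> trA n; apply/cvg_ex; exists (series (fun k => A n k * x k) n.+1).
by apply: cvg_series_finite => k /trA ->; rewrite mul0r.
Qed.

Lemma triangular_applyE A x n : lower_triangular A ->
  infmx_apply A x n = \sum_(k < n.+1) A n k * x k.
Proof.
move=> trA; transitivity (series (fun k => A n k * x k) n.+1);
  last by rewrite seriesEord.
apply/cvg_lim; first exact: norm_hausdorff.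
by apply: cvg_series_finite => k /trA ->; rewrite mul0r.
Qed.

Lemma Omega_triangular : lower_triangular (@Omega_mx K).
Proof. by move=> n k; rewrite /Omega_mx ltnNge => /negbTE ->. Qed.

Lemma U_triangular a : lower_triangular (U_mx a).
Proof. by move=> n k lt_nk; rewrite /U_mx ltnNge ltnW //= gtn_eqF. Qed.

Lemma Omega_applyE x n :
  infmx_apply Omega_mx x n = \sum_(k < n.+1) k.+1%:R * x k.
Proof.
rewrite triangular_applyE; last exact: Omega_triangular.
by apply: eq_bigr => k _; rewrite /Omega_mx -ltnS ltn_ord.
Qed.

Lemma U_applyE a y n :
  infmx_apply (U_mx a) y n =
  \sum_(k < n) (a k / k.+1%:R - a k.+1 / k.+2%:R) * y k + a n / n.+1%:R * y n.
Proof.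
rewrite triangular_applyE; last exact: U_triangular.
rewrite big_ord_recr /= {2}/U_mx ltnn eqxx; congr (_ + _).
by apply: eq_bigr => k _; rewrite /U_mx ltn_ord.
Qed.

Lemma U_apply_Omega a x n :
  infmx_apply (U_mx a) (infmx_apply Omega_mx x) n =
  series (fun k => a k * x k) n.+1.
Proof.
have scale k : a k / k.+1%:R * (k.+1%:R * x k) = a k * x k.
  by rewrite mulrA divfK ?pnatr_eq0.
rewrite U_applyE seriesEord /=; elim: n => [|n IHn].
  by rewrite big_ord0 add0r Omega_applyE !big_ord1 scale.
(* With [y] the image of [x] under [Omega_mx], the common sum over [k < n] is split off. Since
   [y n.+1 = y n + n.+2%:R * x n.+1], the two terms in [a n.+1 / n.+2%:R * y n] cancel. *)
rewrite big_ord_recr [RHS]big_ord_recr /= -IHn -addrA -[RHS]addrA.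
congr (_ + _); rewrite [infmx_apply _ _ n.+1]Omega_applyE big_ord_recr /=.
by rewrite -Omega_applyE mulrDr scale mulrBl addrA subrK.
Qed.

Lemma Omega_surjective y : exists x, infmx_apply Omega_mx x = y.
Proof.
(* Inverse of [Omega_mx]: backward differences of [y], with value 0 before the first term, divided
   by the weights; the weighted sums then telescope. *)
exists (fun k => (y k - if k is k'.+1 then y k' else 0) / k.+1%:R).
apply/funext => n; rewrite Omega_applyE; elim: n => [|n IHn].
  by rewrite big_ord1 mulrC divfK ?pnatr_eq0 // subr0.
rewrite big_ord_recr /= IHn [X in _ + X]mulrC divfK ?pnatr_eq0 //.
by rewrite addrC subrK.
Qed.

(* Covers both duals: [Z] is [seq_cs] with [Y := seq_c], or [seq_bs] with
   [Y := seq_linfty]. The shift drops the initial empty partial sum. *)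
Lemma dual_Omega_domain X Y Z :
  (forall u, Z u <-> Y (fun n => series u n.+1)) ->
  [set a | forall x, infmx_domain X Omega_mx x -> Z (fun k => a k * x k)]
    = [set a | infmx_class X Y (U_mx a)].
Proof.
move=> ZY; have UE a x : infmx_apply (U_mx a) (infmx_apply Omega_mx x) =
    (fun n => series (fun k => a k * x k) n.+1).
  by apply/funext => n; exact: U_apply_Omega.
apply/seteqP; split=> a /= dual_a.
  (* Surjectivity turns an arbitrary [y] in [X] into the image of some [x], which then lies in the
     domain. *)
  move=> y; have [x <-] := Omega_surjective y => Xy.
  split; first exact/triangular_defined/U_triangular.
  rewrite UE; apply/ZY/dual_a; split=> //.
  exact/triangular_defined/Omega_triangular.
by move=> x [_ /dual_a[_]]; rewrite UE => /ZY.
Qed.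

Lemma seq_cs_shift u : seq_cs u <-> seq_c (fun n => series u n.+1).
Proof.
split=> /cvg_ex[l ul]; apply/cvg_ex; exists l.
  by rewrite (cvg_shiftS (series u)).
by rewrite -(cvg_shiftS (series u)).
Qed.

Lemma seq_bs_shift u : seq_bs u <-> seq_linfty (fun n => series u n.+1).
Proof.
split; rewrite /seq_bs /seq_linfty /= /bounded_near => bu;
  apply: filterS bu => M leM; first by move=> n _; exact: leM.
case=> [|n] _; last exact: leM.
(* The same bound [M] also covers the empty sum: it dominates the norm of a later partial sum, hence
   [0 <= M]. *)
by rewrite seriesEord /= big_ord0 normr0 (le_trans _ (leM 0%N I)).
Qed.

End DualsOfOmegaDomain.

Theorem theorem3p5 (K : numFieldType) :
  beta_dual (infmx_domain seq_c0 Omega_mx)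
    = [set a : nat -> K | infmx_class seq_c0 seq_c (U_mx a)] /\
  beta_dual (infmx_domain seq_c Omega_mx)
    = [set a : nat -> K | infmx_class seq_c seq_c (U_mx a)] /\
  beta_dual (infmx_domain seq_linfty Omega_mx)
    = [set a : nat -> K | infmx_class seq_linfty seq_c (U_mx a)] /\
  gamma_dual (infmx_domain seq_c0 Omega_mx)
    = [set a : nat -> K | infmx_class seq_c0 seq_linfty (U_mx a)] /\
  gamma_dual (infmx_domain seq_c Omega_mx)
    = [set a : nat -> K | infmx_class seq_c seq_linfty (U_mx a)] /\
  gamma_dual (infmx_domain seq_linfty Omega_mx)
    = [set a : nat -> K | infmx_class seq_linfty seq_linfty (U_mx a)].
Proof.
(* The kind of dual fixes only the target space, so each of these covers three source spaces at
   once. *)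
have beta X := dual_Omega_domain K X _ _ (seq_cs_shift K).
have gamma X := dual_Omega_domain K X _ _ (seq_bs_shift K).
do ![split]; [exact: beta | exact: beta | exact: beta | exact: gamma ..].
Qed.
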